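(* Let $a_1,a_2,b_1,b_2\in\mathbb{C}$. Then $U_{a_1,b_1}\cong U_{a_2,b_2}$ as generalized conformal modules over $Vir$ if and only if $b_1=b_2$ and one of the following holds: (a) $a_1=a_2$; (b) $b_1\neq0$ and $(a_1,a_2)=(1,0)$; (c) $b_1\neq0$ and $(a_1,a_2)=(0,1)$.
   Context: The Virasoro conformal algebra is $Vir=\mathbb{C}[\partial]L$ with $[L_\lambda L]=(\partial+2\lambda)L$. A generalized conformal module $V$ over $Vir$ is a $\mathbb{C}[\partial]$-module with a linear map $L_\lambda:V\to V[[\lambda]]$ such that $L_\lambda(\partial v)=(\partial+\lambda)L_\lambda v$ and $L_\lambda(L_\mu v)-L_\mu(L_\lambda v)=(\lambda-\mu)L_{\lambda+\mu}v$ for all $v\in V$. An isomorphism is a bijective $\mathbb{C}[\partial]$-linear map $\phi$ with $\phi(L_\lambda v)=L_\lambda\phi(v)$ ($\phi$ applied coefficientwise in $\lambda$). For $a,b\in\mathbb{C}$, $U_{a,b}=\mathbb{C}[t]$ with $\partial=\frac{d}{dt}$ and $L_\lambda f(t)=e^{-\lambda t}(\partial-a\lambda+b)f(t)=e^{-\lambda t}\big(f'(t)-a\lambda f(t)+bf(t)\big)$; this is a generalized conformal module over $Vir$. *)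

(* Defs.v *)
From HB Require Import structures.
From mathcomp Require Import all_boot all_order all_algebra.
From mathcomp Require Import ring.

Set Implicit Arguments.
Unset Strict Implicit.
Unset Printing Implicit Defensive.

Import Order.TTheory GRing.Theory Num.Theory.
Local Open Scope ring_scope.

(* V[[lambda]]: [u n] is the coefficient of lambda^n. *)
Definition series (V : Type) := nat -> V.

(* V[[lambda, mu]]: [u m n] is the coefficient of lambda^m mu^n. *)
Definition series2 (V : Type) := nat -> nat -> V.

Section Series.
Variable V : zmodType.

Definition mul_lambda (u : series V) : series V :=
  fun n => if n is n'.+1 then u n' else 0.

Definition mul_lambda2 (u : series2 V) : series2 V :=
  fun m n => if m is m'.+1 then u m' n else 0.

Definition mul_mu2 (u : series2 V) : series2 V :=
  fun m n => if n is n'.+1 then u m n' else 0.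

(* u(lambda + mu): the monomial lambda^m mu^n occurs only in
   (lambda + mu)^(m + n). *)
Definition subst_lambda_add_mu (u : series V) : series2 V :=
  fun m n => u (m + n)%N *+ 'C(m + n, m).

End Series.

(* A generalized conformal module over Vir = C[d]L, [L_lambda L] = (d + 2 lambda) L
   (with C replaced by any field k); the k[d]-module is a k-vector space with an
   endomorphism [gcm_d]. *)
Record gcmVir (k : fieldType) := GcmVir {
  gcm_car :> lmodType k;
  gcm_d : {linear gcm_car -> gcm_car};
  gcm_L : gcm_car -> series gcm_car;
  gcm_L_linear : forall n, linear (fun v => gcm_L v n);
  (* L_lambda (d v) = (d + lambda) L_lambda v *)
  gcm_L_d : forall v n,
    gcm_L (gcm_d v) n = gcm_d (gcm_L v n) + mul_lambda (gcm_L v) n;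
  (* L_lambda (L_mu v) - L_mu (L_lambda v)
       = (lambda - mu) L_(lambda + mu) v *)
  gcm_L_bracket : forall v m n,
    gcm_L (gcm_L v n) m - gcm_L (gcm_L v m) n
    = mul_lambda2 (subst_lambda_add_mu (gcm_L v)) m n
      - mul_mu2 (subst_lambda_add_mu (gcm_L v)) m n
}.

Arguments gcm_d {k} V : rename.
Arguments gcm_L {k V} : rename.

(* Commuting with [gcm_d] is k[d]-linearity; commuting with [gcm_L] is
   coefficientwise in lambda. *)
Definition gcm_isomorphic (k : fieldType) (V W : gcmVir k) : Prop :=
  exists phi : {linear V -> W},
    [/\ bijective phi,
        forall v, phi (gcm_d V v) = gcm_d W (phi v)
      & forall v n, phi (gcm_L v n) = gcm_L (phi v) n].

Section Uab.
Variable k : numFieldType.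

(* e^(- lambda t) in k[t][[lambda]], the variable t being 'X. *)
Definition exp_neg_lambda_t : series {poly k} :=
  fun n => (n`!%:R^-1 : k) *: (- 'X) ^+ n.

(* e^(- lambda t) (f' + b f) - lambda e^(- lambda t) (a f) *)
Definition U_L (a b : k) (f : {poly k}) : series {poly k} :=
  fun n => exp_neg_lambda_t n * (f^`() + b *: f)
           - mul_lambda (fun i => exp_neg_lambda_t i * (a *: f)) n.

Local Notation E := exp_neg_lambda_t.
Local Notation E1 := (mul_lambda E).
Local Notation E2 := (mul_lambda E1).

Lemma U_LE a b f n :
  U_L a b f n = E n * (f^`() + b *: f) - E1 n * (a *: f).
Proof. by rewrite /U_L; case: n => //=; rewrite mul0r. Qed.

Lemma exp_neg_deriv n : (E n)^`() = - E1 n.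
Proof.
case: n => [|n] /=; first by rewrite /E derivZ expr0 derivC scaler0 oppr0.
rewrite /E derivZ deriv_exp derivN derivX /= mulN1r mulNrn scalerN.
rewrite -scaler_nat scalerA; congr (- (_ *: _)).
rewrite factS natrM invfM mulrAC mulVf ?mul1r //.
by rewrite pnatr_eq0.
Qed.

Lemma exp_neg_deriv1 n : (E1 n)^`() = - E2 n.
Proof. by case: n => [|n] /=; rewrite ?exp_neg_deriv // deriv0 oppr0. Qed.

Lemma exp_neg_add m n : E (m + n)%N *+ 'C(m + n, m) = E m * E n.
Proof.
rewrite /E -scalerAl -scalerAr scalerA -exprD -scaler_nat scalerA.
have fN0 i : (i`!%:R : k) != 0 by rewrite pnatr_eq0 -lt0n fact_gt0.
congr (_ *: _); have /(congr1 (fun i => i%:R : k)) := bin_fact (leq_addr n m).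
rewrite addKn !natrM => <-.
have bN0 : ('C(m + n, m)%:R : k) != 0 by rewrite pnatr_eq0 -lt0n bin_gt0 leq_addr.
by field; rewrite !fN0 bN0.
Qed.

Lemma exp_neg_add1 m n :
  E1 (m + n)%N *+ 'C(m + n, m) = E1 m * E n + E m * E1 n.
Proof.
have E0 : E 0%N = 1 by rewrite /E expr0 fact0 invr1 scale1r.
case: m n => [|m] [|n].
- by rewrite /= mul0r mulr0 addr0 mul0rn.
- by rewrite add0n bin0 E0 /= mul0r add0r mul1r mulr1n.
- by rewrite addn0 binn E0 /= mulr0 addr0 mulr1 mulr1n.
- rewrite addnS binS mulrnDr addrC; congr (_ + _) => /=.
    by rewrite addSnnS exp_neg_add.
  by rewrite exp_neg_add.
Qed.

Lemma U_L_subst a b f m n :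
  subst_lambda_add_mu (U_L a b f) m n
  = E m * E n * (f^`() + b *: f) - (E1 m * E n + E m * E1 n) * (a *: f).
Proof.
by rewrite /subst_lambda_add_mu U_LE mulrnBl -!mulrnAl exp_neg_add exp_neg_add1.
Qed.

Lemma U_L_linear a b n : linear (fun f => U_L a b f n).
Proof.
move=> c f g; rewrite !U_LE derivD derivZ -!mul_polyC; ring.
Qed.

Lemma U_L_deriv a b f n :
  U_L a b f^`() n = (U_L a b f n)^`() + mul_lambda (U_L a b f) n.
Proof.
have -> : mul_lambda (U_L a b f) n
          = E1 n * (f^`() + b *: f) - E2 n * (a *: f).
  case: n => [|n] /=; rewrite ?U_LE // ?mul0r ?subr0 //.
rewrite !U_LE derivB !derivM exp_neg_deriv exp_neg_deriv1 derivD !derivZ.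
rewrite -!mul_polyC; ring.
Qed.

Lemma U_L_bracket a b f m n :
  U_L a b (U_L a b f n) m - U_L a b (U_L a b f m) n
  = mul_lambda2 (subst_lambda_add_mu (U_L a b f)) m n
    - mul_mu2 (subst_lambda_add_mu (U_L a b f)) m n.
Proof.
have -> : mul_lambda2 (subst_lambda_add_mu (U_L a b f)) m n
    = E1 m * E n * (f^`() + b *: f) - (E2 m * E n + E1 m * E1 n) * (a *: f).
  by case: m => [|m] /=; rewrite ?U_L_subst // !mul0r addr0 mul0r subr0.
have -> : mul_mu2 (subst_lambda_add_mu (U_L a b f)) m n
    = E m * E1 n * (f^`() + b *: f) - (E1 m * E1 n + E m * E2 n) * (a *: f).
  by case: n => [|n] /=; rewrite ?U_L_subst // !mulr0 addr0 !mul0r subr0.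
rewrite !U_LE !derivB !derivM !exp_neg_deriv !exp_neg_deriv1 !derivD !derivZ.
rewrite -!mul_polyC; ring.
Qed.

Definition U (a b : k) : gcmVir k :=
  @GcmVir k {poly k} (@deriv k) (U_L a b) (U_L_linear a b)
    (@U_L_deriv a b) (@U_L_bracket a b).

End Uab.

(* Main.v *)
(* Since phi commutes with d/dt, phi(1) is a nonzero constant.  The coefficient
   of lambda^0 in phi(L_lambda 1) = L_lambda phi(1) forces b1 = b2 =: b.  Let
   p_k be the constant term of phi(t^k).  At t = 0, L_lambda g is of degree at
   most 1 in lambda, so evaluating the intertwining relation there gives
     lambda^1 at t^k :  k p_k + b p_(k+1) + a1 p_k = a2 p_k   (k = 0, 1, 2)
     lambda^2 at 1   :  b p_2 + 2 a1 p_1 = 0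
     lambda^3 at 1   :  b p_3 + 3 a1 p_2 = 0.
   Hence b p_1 = (a2 - a1) p_0, (1 - a1 - a2) p_1 = 0 and
   (2 - 2 a1 - a2) p_2 = 0, which leaves the listed cases.  Conversely, for
   b <> 0 the operator d/dt + b is an isomorphism U_(0,b) -> U_(1,b), because
   (d/dt + b) e^(-lambda t) = e^(-lambda t) (d/dt - lambda + b). *)
Require Import Defs.
From HB Require Import structures.
From mathcomp Require Import all_boot all_order all_algebra.
From mathcomp Require Import complex reals.
From mathcomp Require Import ring.

Set Implicit Arguments.
Unset Strict Implicit.
Unset Printing Implicit Defensive.

Import Order.TTheory GRing.Theory Num.Theory.
Local Open Scope ring_scope.
Local Open Scope complex_scope.

Lemma gcm_isomorphic_refl (k : fieldType) (V : gcmVir k) : gcm_isomorphic V V.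
Proof. by exists idfun; split=> //; exists idfun. Qed.

Lemma gcm_isomorphic_sym (k : fieldType) (V W : gcmVir k) :
  gcm_isomorphic V W -> gcm_isomorphic W V.
Proof.
case=> phi [[psi phiK psiK] phi_d phi_L].
have psi_lin : linear psi by exact: can2_linear phiK psiK.
pose psiM := GRing.isLinear.Build k W V *:%R psi psi_lin.
pose psiL : {linear W -> V} := HB.pack psi psiM.
exists psiL; split=> [|w|w n].
- by exists phi.
- by apply: (can_inj phiK); rewrite phi_d /= !psiK.
- by apply: (can_inj phiK); rewrite phi_L /= !psiK.
Qed.

Section DerivPlusScalar.
Variables (k : numFieldType) (b : k).

Definition deriv_add_scale (f : {poly k}) : {poly k} := f^`() + b *: f.

Lemma deriv_add_scale_linear : linear deriv_add_scale.
Proof.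
move=> c f g; rewrite /deriv_add_scale derivD derivZ -!mul_polyC; ring.
Qed.

HB.instance Definition _ :=
  GRing.isLinear.Build k {poly k} {poly k} *:%R deriv_add_scale
    deriv_add_scale_linear.

Hypothesis b_neq0 : b != 0.

(** For f nonzero, f' has smaller size than b f, so the two cannot cancel. *)
Lemma deriv_add_scale_inj : injective deriv_add_scale.
Proof.
apply: raddf_inj => f /eqP; rewrite addr_eq0 => /eqP f'E.
apply/eqP/negPn/negP => /lt_size_deriv.
by rewrite f'E size_polyN size_scale // ltnn.
Qed.

(** Induction on the size: with D = d/dt + b, if D f = g' then D (g - f) = b g. The boolean [==]
    lets [xchoose] pick the preimage. *)
Lemma deriv_add_scale_surj g : exists f, deriv_add_scale f == g.
Proof.
have [n] := ubnP (size g); elim: n g => // n IHn g; rewrite ltnS => size_g.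
have [->|g_neq0] := eqVneq g 0; first by exists 0; rewrite linear0.
have [f /eqP fE] := IHn g^`() (leq_trans (lt_size_deriv g_neq0) size_g).
exists (b^-1 *: (g - f)); rewrite linearZ linearB /= fE /deriv_add_scale.
by rewrite addrAC subrr add0r scalerA mulVf // scale1r.
Qed.

Lemma deriv_add_scale_bij : bijective deriv_add_scale.
Proof.
have gK : cancel (fun g => xchoose (deriv_add_scale_surj g)) deriv_add_scale.
  by move=> g; apply/eqP; exact: xchooseP (deriv_add_scale_surj g).
exists (fun g => xchoose (deriv_add_scale_surj g)) => //.
exact: inj_can_sym gK deriv_add_scale_inj.
Qed.

Lemma gcm_isomorphic_U01 : gcm_isomorphic (U 0 b) (U 1 b).
Proof.
exists deriv_add_scale; split=> [|f|f n]; first exact: deriv_add_scale_bij.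
  by rewrite /= /deriv_add_scale derivD derivZ.
(* Both sides are the lambda^n coefficient of D e^(-lambda t) D f, where D = d/dt + b. *)
rewrite /= !U_LE /deriv_add_scale derivB !derivM exp_neg_deriv exp_neg_deriv1.
rewrite !derivD !derivZ -!mul_polyC; ring.
Qed.

End DerivPlusScalar.

Lemma poly_deriv_eq0 (k : numFieldType) (f : {poly k}) :
  f^`() = 0 -> f = (f`_0)%:P.
Proof.
move=> f'0; apply/polyP => -[|i]; rewrite coefC //=.
have /eqP : f^`()`_i = 0 by rewrite f'0 coef0.
by rewrite coef_deriv mulrn_eq0 => /eqP.
Qed.

Lemma U_L_Xn (k : numFieldType) (a b : k) m n :
  U_L a b 'X^m n.+1 = ((-1) ^+ n.+1 / n.+1`!%:R) *:
    ((m%:R + a * n.+1%:R) *: 'X^(m + n) + b *: 'X^(m + n.+1)).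
Proof.
have XE i : exp_neg_lambda_t k i = ((-1) ^+ i / i`!%:R) *: 'X^i.
  by rewrite /exp_neg_lambda_t -scaleN1r exprZn scalerA mulrC.
(* At m = 0 the truncated exponent m - 1 is harmless, since the factor m vanishes. *)
have dX : 'X^(n.+1) * ('X^m)^`() = m%:R *: 'X^(m + n) :> {poly k}.
  rewrite derivXn mulrnAr -exprD scaler_nat.
  by case: m => [|m]; rewrite ?mulr0n //= addSnnS addnC.
rewrite U_LE /= !XE -scalerAl mulrDr dX -scalerAr -exprD -scalerAl -scalerAr.
rewrite -exprD [(n.+1 + m)%N]addnC [(n + m)%N]addnC factS natrM invfM exprS.
have : n.+1%:R != 0 :> k by rewrite pnatr_eq0.
have : n`!%:R != 0 :> k by rewrite pnatr_eq0 -lt0n fact_gt0.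
move: (n`!%:R : k) (n.+1%:R : k) => c d c_neq0 d_neq0.
rewrite !(scalerDr, scalerA) addrAC -scalerBl.
by congr (_ *: _ + _ *: _); field; rewrite c_neq0.
Qed.

Section Necessity.
Variables (k : numFieldType) (a1 a2 b1 b2 : k).
Variable phi : {linear U a1 b1 -> U a2 b2}.
Hypothesis phi_inj : injective phi.
Hypothesis phi_d : forall f, phi (gcm_d (U a1 b1) f) = gcm_d (U a2 b2) (phi f).
Hypothesis phi_L : forall f n, phi (gcm_L f n) = gcm_L (phi f) n.

Let p n : k := (phi 'X^n : {poly k})`_0.

Lemma intertwiner1_const : phi 1 = (p 0)%:P.
Proof.
apply: poly_deriv_eq0; have := phi_d 1; rewrite /= derivC => <-.
exact: linear0.
Qed.

Lemma p0_neq0 : p 0 != 0.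
Proof.
apply/eqP => p0; have := intertwiner1_const; rewrite p0 => phi1.
have /eqP := phi_inj (etrans phi1 (esym (linear0 phi))).
by rewrite oner_eq0.
Qed.

Lemma intertwiner_eq_b : b1 = b2.
Proof.
have := phi_L 1 0; rewrite /= !U_LE intertwiner1_const /=.
rewrite /exp_neg_lambda_t expr0 fact0 invr1 scale1r !mul1r !mul0r !subr0.
rewrite !derivC !add0r linearZ /= intertwiner1_const.
by rewrite -!mul_polyC -!polyCM => /polyC_inj /(mulIf p0_neq0).
Qed.

(** Constant terms of the lambda^(n+1) coefficients of the intertwining relation at t^m, divided by
    (-1)^(n+1) / (n+1)!. The target side contributes only at lambda^1, whence the factor
    [(n == 0)%:R]. *)
Lemma intertwiner_rec m n :
  (m%:R + a1 * n.+1%:R) * p (m + n) + b1 * p (m + n.+1)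
  = (n == 0)%:R * a2 * p m.
Proof.
have := phi_L 'X^m n.+1; rewrite /= U_L_Xn linearZ linearD !linearZ /=.
move=> /(congr1 (fun f : {poly k} => f`_0)).
rewrite U_LE /= coefB !coef0M coefZ /exp_neg_lambda_t !coefZ coefD !coefZ.
have coef0X i : ((- 'X) ^+ i : {poly k})`_0 = (i == 0)%:R.
  by rewrite -horner_coef0 !hornerE oppr0 expr0n.
rewrite !coef0X mulr0 mul0r sub0r -!/(p _).
set c := _ / _ => E.
have c_neq0 : c != 0.
  by rewrite mulf_neq0 ?signr_eq0 // invr_eq0 pnatr_eq0 -lt0n fact_gt0.
apply: (mulfI c_neq0); rewrite E /c.
(* For n = 0 the scalar is -1 and absorbs the sign of - a2 lambda. *)
case: n {E c c_neq0} => [|n] /=; last by rewrite !(mulr0, mul0r) oppr0.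
by rewrite (factS 0) fact0 muln1 !invr1 expr1 /p; ring.
Qed.

Lemma intertwiner_cases :
  [\/ a1 = a2, b1 <> 0 /\ (a1, a2) = (1, 0) | b1 <> 0 /\ (a1, a2) = (0, 1)].
Proof.
have := (intertwiner_rec 0 0, intertwiner_rec 1 0, intertwiner_rec 2 0,
         intertwiner_rec 0 1, intertwiner_rec 0 2).
rewrite !add0n !addn0 !addn1 /= => -[[[[E0 E1] E2] F1] F2].
(* Subtracting [F1] from [E1] eliminates b1 p_2; likewise [E2] and [F2] share b1 p_3. *)
have p1E : (1 - a1 - a2) * p 1 = 0.
  transitivity ((1%:R + a1 * 1%:R) * p 1 + b1 * p 2 - 1%:R * a2 * p 1
     - ((0%:R + a1 * 2%:R) * p 1 + b1 * p 2 - 0%:R * a2 * p 0)); first by ring.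
  by rewrite E1 F1 !subrr.
have p2E : (2 - a1 *+ 2 - a2) * p 2 = 0.
  transitivity ((2%:R + a1 * 1%:R) * p 2 + b1 * p 3 - 1%:R * a2 * p 2
     - ((0%:R + a1 * 3%:R) * p 2 + b1 * p 3 - 0%:R * a2 * p 0)); first by ring.
  by rewrite E2 F2 !subrr.
have [a12|a12] := eqVneq a1 a2; first by constructor 1.
have bp1 : b1 * p 1 = (a2 - a1) * p 0.
  transitivity ((0%:R + a1 * 1%:R) * p 0 + b1 * p 1 - a1 * p 0); first by ring.
  by rewrite E0; ring.
have : b1 * p 1 != 0 by rewrite bp1 mulf_neq0 ?p0_neq0 // subr_eq0 eq_sym.
rewrite mulf_eq0 negb_or => /andP[/eqP b_neq0 p1_neq0].
move/eqP: p1E; rewrite mulf_eq0 (negPf p1_neq0) orbF => /eqP a12_1.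
have a2E : a2 = 1 - a1 by rewrite -[a2]addr0 -a12_1; ring.
(* Either 2 - 2 a1 - a2 = 0, which with a1 + a2 = 1 gives a1 = 1, or p_2 = 0, and then [F1] reduces
   to 2 a1 p_1 = 0 with p_1 nonzero. *)
move/eqP: p2E; rewrite mulf_eq0 => /orP[] /eqP Z.
  have a1E : a1 = 1 by rewrite -[a1]addr0 -Z a2E; ring.
  by constructor 2; rewrite a2E a1E subrr.
have a1E : a1 = 0.
  have : a1 * 2%:R * p 1 = 0.
    transitivity ((0%:R + a1 * 2%:R) * p 1 + b1 * p 2); last first.
      by rewrite F1; ring.
    by rewrite Z; ring.
  by move/eqP; rewrite !mulf_eq0 (negPf p1_neq0) pnatr_eq0 !orbF => /eqP.
by constructor 3; rewrite a2E a1E subr0.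
Qed.

End Necessity.

Theorem proposition5p6 (R : realType) (a1 a2 b1 b2 : R[i]) :
  gcm_isomorphic (U a1 b1) (U a2 b2) <->
  b1 = b2 /\
  [\/ a1 = a2,
      b1 <> 0 /\ (a1, a2) = (1, 0)
    | b1 <> 0 /\ (a1, a2) = (0, 1)].
Proof.
split=> [[phi [/bij_inj phi_inj phi_d phi_L]]|[<-]].
  split; first exact: intertwiner_eq_b phi_inj phi_d phi_L.
  exact: intertwiner_cases phi_inj phi_d phi_L.
case=> [<-|[/eqP b_neq0 [-> ->]]|[/eqP b_neq0 [-> ->]]].
- exact: gcm_isomorphic_refl.
- exact/gcm_isomorphic_sym/gcm_isomorphic_U01.
- exact: gcm_isomorphic_U01.
Qed.
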